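(* Let $\mathcal{Q}=\{1,2,\dots,6\}$, let $0<k<1/\sqrt2$, let $\{u_1,u_2,u_3\}$ be an orthonormal set of vectors in $\mathbb{R}^3$, and let $u_{m+3}=-u_m$ for $m\in\{1,2,3\}$. Define $V:SO(3)\to\mathbb{R}$ and $\Gamma:SO(3)\times\mathcal{Q}\to SO(3)$ by $$V(R)=1-\sqrt{1-|R|_I^2},\qquad \Gamma(R,q)=R\,\mathcal{R}\big(2\arcsin(k|R|_I^2),u_q\big).$$ Let $\mathcal{D}=\{(R,q)\in SO(3)\times\mathcal{Q}:\ |\Gamma(R,q)|_I\neq1\}$. Then $V\circ\Gamma\in\mathcal{P}_{\mathcal{D}}$. Moreover, $V\circ\Gamma$ is exp-synergistic with a gap $$\delta>\bar\delta:=\frac{\big[-1+\sqrt{1+4k^2}\big]^{3/2}}{2\sqrt6\,k^2}.$$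
   Context: Notation. $SO(3)=\{R\in\mathbb{R}^{3\times3}: \det R=1,\ RR^\top=I\}$, with tangent spaces $T_RSO(3)=\{R\Omega:\Omega\in\mathfrak{so}(3)\}$, where $\mathfrak{so}(3)$ is the space of skew-symmetric $3\times3$ matrices. $[x]_\times$ is the skew-symmetric matrix with $[x]_\times y=x\times y$. $|R|_I\in[0,1]$ is defined by $|R|_I^2=\mathrm{tr}(I-R)/4$. For $\theta\in\mathbb{R}$ and a unit vector $u\in\mathbb{R}^3$, $\mathcal{R}(\theta,u)=I+\sin(\theta)[u]_\times+(1-\cos\theta)[u]_\times^2$. $\|\cdot\|_F$ is the Frobenius norm. Gradients $\nabla\mathcal{U}(R,q)\in T_RSO(3)$ are taken with respect to $R$, relative to the left-invariant Riemannian metric $\langle R\Omega_1,R\Omega_2\rangle_R=\mathrm{tr}(\Omega_1^\top\Omega_2)$. $(V\circ\Gamma)(R,q)=V(\Gamma(R,q))$. Potential functions. Let $\mathcal{A}=\{I\}\times\mathcal{Q}$ and write $\mathcal{D}=\bigcup_{q\in\mathcal{Q}}D_q\times\{q\}\subseteq SO(3)\times\mathcal{Q}$. $\mathcal{P}_{\mathcal{D}}$ is the set of continuous functions $\mathcal{U}:SO(3)\times\mathcal{Q}\to\mathbb{R}^+$ ($\mathbb{R}^+$ = nonnegative reals) such that $\mathcal{U}(R,q)>0$ for $(R,q)\notin\mathcal{A}$, $\mathcal{U}(R,q)=0$ for $(R,q)\in\mathcal{A}$, and $\mathcal{U}$ is continuously differentiable on $\mathcal{D}$ (i.e. $R\mapsto\mathcal{U}(R,q)$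 is $C^1$ on $D_q$ for each $q$). Exp-synergism. Given $\delta>0$ and $C:=\{(R,q)\in SO(3)\times\mathcal{Q}:\ \mathcal{U}(R,q)-\min_{m\in\mathcal{Q}}\mathcal{U}(R,m)\le\delta\}$, a function $\mathcal{U}\in\mathcal{P}_{\mathcal{D}}$ is exp-synergistic, with gap exceeding $\delta$, if and only if there exist constants $\alpha_1,\dots,\alpha_4>0$ such that: $\alpha_1|R|_I^2\le\mathcal{U}(R,q)\le\alpha_2|R|_I^2$ for all $(R,q)\in SO(3)\times\mathcal{Q}$; $\alpha_3|R|_I^2\le\|\nabla\mathcal{U}(R,q)\|_F^2\le\alpha_4|R|_I^2$ for all $(R,q)\in C$; and $C\subseteq\mathcal{D}$. *)

(* Defs.v *)
From HB Require Import structures.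
From mathcomp Require Import all_boot all_order all_algebra.
From mathcomp Require Import all_classical all_reals all_analysis.
From mathcomp Require Import ring lra.

Set Implicit Arguments.
Unset Strict Implicit.
Unset Printing Implicit Defensive.

Import Order.TTheory GRing.Theory Num.Theory.
Import numFieldNormedType.Exports.

Local Open Scope classical_set_scope.
Local Open Scope ring_scope.

Section RotationGroup.
Context {R : realType}.

Definition SO3 : set 'M[R]_3 := [set X | \det X = 1 /\ X *m X^T = 1%:M].

Definition so3 : set 'M[R]_3 := [set Omega | Omega^T = - Omega].

Definition tangentSO3 (X : 'M[R]_3) : set 'M[R]_3 := [set X *m Omega | Omega in so3].

(* For X in SO3 and A = X Omega, X^T A = Omega: this is tr(Omega1^T Omega2). *)
Definition metricSO3 (X A B : 'M[R]_3) : R :=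
  \tr ((X^T *m A)^T *m (X^T *m B)).

Definition frobenius (A : 'M[R]_3) : R := Num.sqrt (\tr (A^T *m A)).

Definition normI (X : 'M[R]_3) : R := Num.sqrt (\tr (1%:M - X) / 4).

Definition crossmx (x : 'cV[R]_3) : 'M[R]_3 :=
  let x0 := x 0 0 in let x1 := x 1 0 in let x2 := x 2%:R 0 in
  \matrix_(i < 3, j < 3)
    nth 0 (nth [::] [:: [::   0; - x2;   x1];
                        [::  x2;    0; - x0];
                        [:: - x1;  x0;    0] ] i) j.

Definition rodrigues (theta : R) (u : 'cV[R]_3) : 'M[R]_3 :=
  1%:M + sin theta *: crossmx u + (1 - cos theta) *: (crossmx u *m crossmx u).

End RotationGroup.

(* Functions on SO(3), or on SO(3) x Q, are represented by functions on all
   3 x 3 matrices; every notion below depends only on their values on SO3. *)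
Section PotentialFunctions.
Context {R : realType}.

(* Continuity of X |-> 'd F X is tested on each direction H, which is
   equivalent to operator-norm continuity in finite dimension. *)
Definition C1_on (W : set 'M[R]_3) (F : 'M[R]_3 -> R) : Prop :=
  (forall X, W X -> differentiable F X) /\
  (forall H : 'M[R]_3, {in W, continuous (fun X => 'd F X H)}).

(* SO(3) is an embedded submanifold of R^(3 x 3): F is a C^1 extension of f
   to a neighbourhood of X in the ambient space. *)
Definition C1_extension_at (f : 'M[R]_3 -> R) (X : 'M[R]_3) (F : 'M[R]_3 -> R) :
    Prop :=
  exists W : set 'M[R]_3,
    [/\ open W, W X, C1_on W F & {in W `&` SO3, F =1 f}].

Definition C1_SO3_on (D : set 'M[R]_3) (f : 'M[R]_3 -> R) : Prop :=
  forall X, D X -> exists F, C1_extension_at f X F.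

(* The differential of f at X is the restriction to the tangent space of the
   differential of any local C^1 extension of f. *)
Definition is_gradient (f : 'M[R]_3 -> R) (X G : 'M[R]_3) : Prop :=
  tangentSO3 X G /\
  exists2 F, C1_extension_at f X F &
    forall H, tangentSO3 X H -> 'd F X H = metricSO3 X G H.

(* Junk value 0 where f is not C^1 near X. *)
Definition gradSO3 (f : 'M[R]_3 -> R) (X : 'M[R]_3) : 'M[R]_3 :=
  xget 0 [set G | is_gradient f X G].

Variable Q : finType.

(* Q carries the discrete topology, so that continuity on SO(3) x Q is
   continuity in the first variable. *)
Definition potential (D : set ('M[R]_3 * Q)) (U : 'M[R]_3 -> Q -> R) : Prop :=
  [/\ forall X q, SO3 X -> 0 <= U X q,
      forall q, {within SO3, continuous (fun X => U X q)},
      forall X q, SO3 X -> X != 1%:M -> 0 < U X q,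
      forall q, U 1%:M q = 0 &
      forall q, C1_SO3_on [set X | D (X, q)] (fun X => U X q)].

(* The default value U X q of the iterated minimum is one of its terms. *)
Definition flow_set (delta : R) (U : 'M[R]_3 -> Q -> R) : set ('M[R]_3 * Q) :=
  [set p | SO3 p.1 /\
     U p.1 p.2 - \big[Order.min/U p.1 p.2]_(m : Q) U p.1 m <= delta].

Definition exp_synergistic (D : set ('M[R]_3 * Q)) (delta : R)
    (U : 'M[R]_3 -> Q -> R) : Prop :=
  [/\ 0 < delta, potential D U &
   exists a1 a2 a3 a4 : R,
    [/\ [/\ 0 < a1, 0 < a2, 0 < a3 & 0 < a4],
        forall X q, SO3 X ->
          a1 * normI X ^+ 2 <= U X q <= a2 * normI X ^+ 2,
        forall X q, flow_set delta U (X, q) ->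
          a3 * normI X ^+ 2 <= frobenius (gradSO3 (fun Y => U Y q) X) ^+ 2
                            <= a4 * normI X ^+ 2 &
        flow_set delta U `<=` D]].

End PotentialFunctions.

Section AngularWarping.
Context {R : realType}.

Definition V (X : 'M[R]_3) : R := 1 - Num.sqrt (1 - normI X ^+ 2).

Definition Gamma (Q : Type) (k : R) (u : Q -> 'cV[R]_3) (X : 'M[R]_3) (q : Q) :
    'M[R]_3 :=
  X *m rodrigues (2 * asin (k * normI X ^+ 2)) (u q).

Lemma crossmxE (x y : 'cV[R]_3) :
  crossmx x *m y =
  \col_i nth 0 [:: x 1 0 * y 2%:R 0 - x 2%:R 0 * y 1 0;
                   x 2%:R 0 * y 0 0 - x 0 0 * y 2%:R 0;
                   x 0 0 * y 1 0 - x 1 0 * y 0 0] (i : 'I_3).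
Proof.
apply/colP => i; rewrite !mxE !big_ord_recl big_ord0 !mxE /=.
have -> : lift ord0 ord0 = 1 :> 'I_3 by apply/val_inj.
have -> : lift ord0 (lift ord0 ord0) = 2%:R :> 'I_3 by apply/val_inj.
have -> : ord0 = 0 :> 'I_3 by apply/val_inj.
by case: i => [[|[|[|//]]] ?] /=; ring.
Qed.

Lemma rodrigues_SO3 (theta : R) (u : 'cV[R]_3) :
  (u^T *m u) 0 0 = 1 -> SO3 (rodrigues theta u).
Proof.
have e1 : lift ord0 ord0 = 1 :> 'I_3 by apply/val_inj.
have e2 : lift ord0 (lift ord0 ord0) = 2%:R :> 'I_3 by apply/val_inj.
have e0 : ord0 = 0 :> 'I_3 by apply/val_inj.
rewrite !mxE !big_ord_recl big_ord0 !mxE /= e1 e2 e0 addr0.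
set n := (X in X = 1) => hn.
have hcs := cos2Dsin2 theta.
rewrite /rodrigues; set s := sin theta; set t := 1 - cos theta.
have hst : 2 * t - s ^+ 2 - t ^+ 2 = 0.
  by move: hcs; rewrite /t /s; lra.
set K := crossmx u.
have KT : K^T = - K.
  apply/matrixP => i j; rewrite /K !mxE.
  by case: i => [[|[|[|//]]] ?]; case: j => [[|[|[|//]]] ?] /=; ring.
have K3 : K *m (K *m K) = - K.
  rewrite -[RHS]scale1r -hn /n; apply/matrixP => i j.
  rewrite /K !(mxE, big_ord_recl, big_ord0) /= ?e1 ?e2 ?e0.
  by case: i => [[|[|[|//]]] ?]; case: j => [[|[|[|//]]] ?] /=; ring.
split.
  transitivity ((1 - t * n) ^+ 2 + s ^+ 2 * n); last first.
    by rewrite hn; move: hcs; rewrite /t /s; lra.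
  rewrite /n /K (expand_det_row _ 0) !big_ord_recl big_ord0 /cofactor.
  rewrite !(expand_det_row _ 0) !big_ord_recl !big_ord0 /cofactor !det_mx11.
  rewrite !(mxE, big_ord_recl, big_ord0) /= ?e1 ?e2 ?e0 /=.
  by rewrite /bump /=; ring.
have K2T : (K *m K)^T = K *m K by rewrite trmx_mul KT mulNmx mulmxN opprK.
rewrite !raddfD /= !linearZ /= trmx1 K2T KT.
have K3' : K *m K *m K = - K by rewrite -mulmxA.
have K4 : K *m K *m (K *m K) = - (K *m K) by rewrite mulmxA K3' mulNmx.
rewrite !mulmxDl !mul1mx !mulmx1 -!scalemxAl.
rewrite !mulmxN K3 K3' K4.
rewrite -[RHS]addr0 -[X in _ = _ + X](scale0r (K *m K)) -hst.
move: (K *m K) => L; move: K {K2T K3 K3' K4 KT} => K.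
by apply/matrixP => i j; rewrite !mxE; ring.
Qed.

Lemma Gamma_SO3 (Q : Type) (k : R) (u : Q -> 'cV[R]_3) (X : 'M[R]_3) (q : Q) :
  ((u q)^T *m u q) 0 0 = 1 -> SO3 X -> SO3 (Gamma k u X q).
Proof.
move=> /(rodrigues_SO3 (2 * asin (k * normI X ^+ 2))) [dS oS] [dX oX].
split; first by rewrite det_mulmx dX dS mulr1.
by rewrite trmx_mul mulmxA -[X *m _ *m _]mulmxA oS mulmx1.
Qed.

End AngularWarping.

(* Main.v *)
Require Import Defs.
From HB Require Import structures.
From mathcomp Require Import all_boot all_order all_algebra.
From mathcomp Require Import all_classical all_reals all_analysis.
From mathcomp Require Import ring lra.
Import Order.TTheory GRing.Theory Num.Theory.
Import numFieldNormedType.Exports.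
Local Open Scope classical_set_scope.
Local Open Scope ring_scope.

(** Write a rotation in unit quaternion form, X = 1 + 2 h [e] + 2 [e]^2 with
    h^2 + |e|^2 = 1 ([SO3_quat]).  With s = |e|^2 one has |X|_I^2 = s.  The
    warping multiplies this quaternion by one whose vector part is k s u_q and
    whose real part is c = sqrt (1 - k^2 s^2), so the warped rotation has real
    part n = h c - k s (e . u_q), and the potential is 1 - |n| ([V_Gamma]).  The
    proposition then becomes a statement about the real number n.

    Quadratic bounds.  The vector part of the warped quaternion gives the
    factorization 1 - n^2 = s ((c + z)^2 + k^2 (s - p^2)), with p = e . u_q and
    z = k h p ([warped_real_sq]); the bracket is bounded above, and below because
    c + 2 z >= 1/6.  Here k^2 < 1/2 is used: z^2 <= k^2 h^2 s and
    c^2 - 4 k^2 h^2 s = 1 - k^2 (4 s - 3 s^2) >= 1/3 ([warp_margin]).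

    Gradient.  In the direction X [v] the derivative of n is -1/2 (w . v) for an
    explicit vector w ([gradvec]), and |w|^2 factors like 1 - n^2, as
    s ((A + z)^2 + k^2 (s - p^2)) ([dot_gradvec]).  Since
    c (A + z) = c^2 + 3 c z + 2 k^2 h^2 s >= (c + z) (c + 2 z), the same margin
    bounds the bracket from below, everywhere and not only on the flow set.  The
    potential is differentiable wherever n <> 0, and the squared gradient norm
    is |w|^2 / 8.

    Gap.  Where n = 0 the potential is at its maximum 1, and
    (h c)^2 = k^2 s^2 p^2 <= k^2 s^3 forces s >= r, the root of 1 - r = k^2 r^2
    ([singular_radius_le]).  Since u_1, u_2, u_3 is orthonormal, some |e . u_i| is
    at least sqrt (s / 3); with the right sign of u_i the potential drops there to
    at most 1 - (|h| c + k s sqrt (s / 3)) ([large_warped_real]).  The threshold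
    of the proposition is k r sqrt (r / 3), the value of the second summand at
    s = r.  The drop exceeds it uniformly: the second summand grows with s, and
    the first one is positive unless s = 1, whereas r < 1 ([gap_bound_gt],
    [gap_bound_le]).  A delta strictly between the two keeps every point with
    n = 0 out of the flow set. *)

Section ExpSynergism.
Context {R : realType}.
Implicit Types (x y u v e : 'cV[R]_3) (A B X : 'M[R]_3).

(** * Vectors and matrices of size three *)

Definition dot x y : R := (x^T *m y) 0 0.

Lemma big_ord3 (F : 'I_3 -> R) : \sum_i F i = F 0 + F 1 + F 2%:R.
Proof.
rewrite !big_ord_recl big_ord0 addr0 addrA.
by congr (_ + F _ + F _); apply/val_inj.
Qed.

(** Case analysis on an index, with the cases written 0, 1, 2 as in [big_ord3]
    and [crossmx] instead of as explicit ordinals. *)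
Lemma ord3P (P : 'I_3 -> Prop) : P 0 -> P 1 -> P 2%:R -> forall i, P i.
Proof.
move=> P0 P1 P2; case=> [[|[|[|//]]] i3].
- by have -> : Ordinal i3 = 0 by apply/val_inj.
- by have -> : Ordinal i3 = 1 by apply/val_inj.
- by have -> : Ordinal i3 = 2%:R by apply/val_inj.
Qed.

Lemma dotE x y : dot x y = x 0 0 * y 0 0 + x 1 0 * y 1 0 + x 2%:R 0 * y 2%:R 0.
Proof. by rewrite /dot mxE big_ord3 !mxE. Qed.

Lemma dotC u v : dot u v = dot v u.
Proof. by rewrite !dotE; ring. Qed.

Lemma dotDl x y v : dot (x + y) v = dot x v + dot y v.
Proof. by rewrite !dotE !mxE; ring. Qed.

Lemma dotZl a y v : dot (a *: y) v = a * dot y v.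
Proof. by rewrite !dotE !mxE; ring. Qed.

Lemma dotDr x y v : dot v (x + y) = dot v x + dot v y.
Proof. by rewrite !dotE !mxE; ring. Qed.

Lemma dotZr a y v : dot v (a *: y) = a * dot v y.
Proof. by rewrite !dotE !mxE; ring. Qed.

Lemma dot_ge0 e : 0 <= dot e e.
Proof. by rewrite dotE -!expr2 !addr_ge0 ?sqr_ge0. Qed.

Lemma dot_eq0 e : dot e e = 0 -> e = 0.
Proof.
rewrite dotE -!expr2 => e0; apply/matrixP => i j; rewrite ord1 mxE.
apply/eqP; rewrite -sqrf_eq0; apply/eqP.
move: (sqr_ge0 (e 0 0)) (sqr_ge0 (e 1 0)) (sqr_ge0 (e 2%:R 0)).
by elim/ord3P: i; lra.
Qed.

Lemma mxtrace3 A : \tr A = A 0 0 + A 1 1 + A 2%:R 2%:R.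
Proof. exact: big_ord3. Qed.

Lemma mulmx3E A B i j :
  (A *m B) i j = A i 0 * B 0 j + A i 1 * B 1 j + A i 2%:R * B 2%:R j.
Proof. by rewrite mxE big_ord3. Qed.

(** * Rotations as unit quaternions *)

(** The rotation of the unit quaternion with real part h and vector part e. *)
Definition quatmx (h : R) e : 'M[R]_3 :=
  1%:M + (2 * h) *: crossmx e + 2 *: (crossmx e *m crossmx e).

Definition col3 (a b c : R) : 'cV[R]_3 := \col_i nth 0 [:: a; b; c] (i : 'I_3).

Lemma det2E (A : 'M[R]_2) : \det A = A 0 0 * A 1 1 - A 0 1 * A 1 0.
Proof.
have l0 : lift 0 0 = 1 :> 'I_2 by apply/val_inj.
have l1 : lift 1 0 = 0 :> 'I_2 by apply/val_inj.
rewrite (expand_det_row _ 0) !big_ord_recl big_ord0 /cofactor !det_mx11 !mxE.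
by rewrite !l0 !l1 /=; ring.
Qed.

Lemma det3E X : \det X =
  X 0 0 * (X 1 1 * X 2%:R 2%:R - X 1 2%:R * X 2%:R 1)
  - X 0 1 * (X 1 0 * X 2%:R 2%:R - X 1 2%:R * X 2%:R 0)
  + X 0 2%:R * (X 1 0 * X 2%:R 1 - X 1 1 * X 2%:R 0).
Proof.
have l00 : lift 0 0 = 1 :> 'I_3 by apply/val_inj.
have l01 : lift 0 1 = 2%:R :> 'I_3 by apply/val_inj.
have l10 : lift 1 0 = 0 :> 'I_3 by apply/val_inj.
have l11 : lift 1 1 = 2%:R :> 'I_3 by apply/val_inj.
have l20 : lift 2%:R 0 = 0 :> 'I_3 by apply/val_inj.
have l21 : lift 2%:R 1 = 1 :> 'I_3 by apply/val_inj.
rewrite (expand_det_row _ 0) big_ord3 /cofactor !det2E !mxE.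
rewrite ?l00 ?l01 ?l10 ?l11 ?l20 ?l21 /=; ring.
Qed.

(** The signs of the cofactors are absorbed by the cyclic order of the rows and
    columns. *)
Definition cofmx X : 'M[R]_3 := \matrix_(i < 3, j < 3)
  nth 0 (nth [::]
   [:: [:: X 1 1 * X 2%:R 2%:R - X 1 2%:R * X 2%:R 1;
           X 1 2%:R * X 2%:R 0 - X 1 0 * X 2%:R 2%:R;
           X 1 0 * X 2%:R 1 - X 1 1 * X 2%:R 0];
       [:: X 2%:R 1 * X 0 2%:R - X 2%:R 2%:R * X 0 1;
           X 2%:R 2%:R * X 0 0 - X 2%:R 0 * X 0 2%:R;
           X 2%:R 0 * X 0 1 - X 2%:R 1 * X 0 0];
       [:: X 0 1 * X 1 2%:R - X 0 2%:R * X 1 1;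
           X 0 2%:R * X 1 0 - X 0 0 * X 1 2%:R;
           X 0 0 * X 1 1 - X 0 1 * X 1 0]] i) j.

(** The transposed cofactor matrix is det X times the inverse of X, and here the
    determinant is 1 and the inverse is the transpose. *)
Lemma SO3_cofmx X : SO3 X -> cofmx X = X.
Proof.
move=> [dX oX].
have : X *m (cofmx X)^T = 1%:M.
  apply/matrixP => i j; rewrite -[1]dX det3E.
  by elim/ord3P: i; elim/ord3P: j; rewrite !mxE big_ord3 !mxE /=; ring.
move/(congr1 (mulmx X^T)); rewrite mulmxA (mulmx1C oX) mul1mx mulmx1.
by move/(congr1 trmx); rewrite !trmxK.
Qed.

(** A matrix whose 2 x 2 minors through a positive diagonal entry vanish is a
    square q q^T: a rescaled row of the matrix serves as q. *)
Lemma rank1_factor n (M : 'I_n -> 'I_n -> R) i : 0 < M i i ->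
  (forall j k, M i j * M i k = M i i * M j k) ->
  exists q : 'I_n -> R, forall j k, q j * q k = M j k.
Proof.
move=> Mi HM; exists (fun j => M i j / Num.sqrt (M i i)) => j k.
have r2 : Num.sqrt (M i i) ^+ 2 = M i i by rewrite sqr_sqrtr ?ltW.
by rewrite mulrACA -invfM -expr2 r2 HM mulrAC divff ?mul1r // gt_eqF.
Qed.

(** The entries of X are affine in the products q_i q_j of the components of its
    quaternion q; solving for these products gives q q^T without square roots. *)
Definition quat_outer X (i j : 'I_4) : R :=
  nth 0 (nth [::]
   [:: [:: 1 + X 0 0 + X 1 1 + X 2%:R 2%:R; X 2%:R 1 - X 1 2%:R;
           X 0 2%:R - X 2%:R 0; X 1 0 - X 0 1];
       [:: X 2%:R 1 - X 1 2%:R; 1 + X 0 0 - X 1 1 - X 2%:R 2%:R;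
           X 0 1 + X 1 0; X 0 2%:R + X 2%:R 0];
       [:: X 0 2%:R - X 2%:R 0; X 0 1 + X 1 0;
           1 - X 0 0 + X 1 1 - X 2%:R 2%:R; X 1 2%:R + X 2%:R 1];
       [:: X 1 0 - X 0 1; X 0 2%:R + X 2%:R 0; X 1 2%:R + X 2%:R 1;
           1 - X 0 0 - X 1 1 + X 2%:R 2%:R]] i) j / 4.

(** Each identity is a linear combination of the quadratic relations satisfied by
    a rotation: orthonormal rows, orthonormal columns, and equality with the
    cofactor matrix. *)
Lemma quat_outer_minors X i j k : SO3 X ->
  quat_outer X i j * quat_outer X i k = quat_outer X i i * quat_outer X j k.
Proof.
move=> SX; have [dX oX] := SX.
have oX' : X^T *m X = 1%:M by apply: mulmx1C.
have en i' j' : cofmx X i' j' = X i' j' by rewrite SO3_cofmx.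
have ro i' j' : (X *m X^T) i' j' = (i' == j')%:R by rewrite oX mxE.
have co i' j' : (X^T *m X) i' j' = (i' == j')%:R by rewrite oX' mxE.
move: (en 0 0) (en 0 1) (en 0 2%:R) (en 1 0) (en 1 1) (en 1 2%:R)
  (en 2%:R 0) (en 2%:R 1) (en 2%:R 2%:R) (ro 0 0) (ro 0 1) (ro 0 2%:R) (ro 1 1)
  (ro 1 2%:R) (ro 2%:R 2%:R)
  (co 0 0) (co 0 1) (co 0 2%:R) (co 1 1) (co 1 2%:R) (co 2%:R 2%:R).
rewrite !mxE !big_ord3 !mxE /= /quat_outer {en ro co dX oX oX' SX}.
move: (X 0 0) (X 0 1) (X 0 2%:R) (X 1 0) (X 1 1) (X 1 2%:R)
  (X 2%:R 0) (X 2%:R 1) (X 2%:R 2%:R) => a b c d e f g h l.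
case: i => [[|[|[|[|//]]]] ?];
case: j => [[|[|[|[|//]]]] ?];
case: k => [[|[|[|[|//]]]] ?] /=;
move=> *; lra.
Qed.

(** The matrix [quat_outer X] has trace 1, hence a positive diagonal entry, and so
    it is q q^T; the components of q are h and e, and the trace is h^2 + |e|^2.
    Not fixing the diagonal entry in advance covers the half-turns, where h = 0. *)
Lemma SO3_quat X : SO3 X ->
  exists h e, h ^+ 2 + dot e e = 1 /\ X = quatmx h e.
Proof.
move=> SX; pose M := quat_outer X.
have trM : M 0 0 + M 1 1 + M 2%:R 2%:R + M 3%:R 3%:R = 1.
  by rewrite /M /quat_outer /=; lra.
have [i Mi] : exists i, 0 < M i i.
  have [|/forallNP Mle0] := pselect (exists i, 0 < M i i); first by [].
  have M0 i : M i i <= 0 by rewrite leNgt; apply/negP.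
  by exfalso; move: (M0 0) (M0 1) (M0 2%:R) (M0 3%:R); lra.
have [q qM] := rank1_factor _ M i Mi (fun j k => quat_outer_minors X i j k SX).
exists (q 0), (col3 (q 1) (q 2%:R) (q 3%:R)).
move: (qM 0 0) (qM 0 1) (qM 0 2%:R) (qM 0 3%:R) (qM 1 1) (qM 1 2%:R)
  (qM 1 3%:R) (qM 2%:R 2%:R) (qM 2%:R 3%:R) (qM 3%:R 3%:R).
move=> q00 q01 q02 q03 q11 q12 q13 q22 q23 q33.
split; first by rewrite dotE !mxE /= expr2 q00 q11 q22 q33 -[RHS]trM !addrA.
apply/matrixP => a b; elim/ord3P: a; elim/ord3P: b;
  rewrite !mxE !big_ord3 !mxE /=;
move: q00 q01 q02 q03 q11 q12 q13 q22 q23 q33; rewrite /M /quat_outer /=; lra.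
Qed.

Lemma crossmx_mul v u : crossmx v *m crossmx u = u *m v^T - (dot u v)%:M.
Proof.
apply/matrixP => i j; rewrite dotE.
elim/ord3P: i; elim/ord3P: j; rewrite !mxE big_ord3 big_ord1 !mxE /=; ring.
Qed.

Lemma tr_quatmx h e : h ^+ 2 + dot e e = 1 -> \tr (quatmx h e) = 4 * h ^+ 2 - 1.
Proof.
rewrite dotE => he.
by rewrite mxtrace3 !mxE !big_ord3 !mxE /=; lra.
Qed.

Lemma tr_quatmx_cross h e u : \tr (quatmx h e *m crossmx u) = - (4 * h) * dot e u.
Proof. by rewrite dotE mxtrace3 !(mxE, big_ord3) /=; ring. Qed.

Lemma dot_quatmx h e u v : h ^+ 2 + dot e e = 1 ->
  dot v (quatmx h e *m u) = (2 * h ^+ 2 - 1) * dot u v + 2 * dot e u * dot e v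
    + 2 * h * dot v (crossmx e *m u).
Proof.
move=> he; have -> : 2 * h ^+ 2 - 1 = h ^+ 2 - dot e e by rewrite -[X in _ - X]he; ring.
(* The homogeneous form makes the identity polynomial in h and e. *)
have -> : quatmx h e = (h ^+ 2 + dot e e)%:M + (2 * h) *: crossmx e
    + 2 *: (crossmx e *m crossmx e).
  by rewrite he.
by rewrite !dotE !(mxE, big_ord3) /=; ring.
Qed.

Lemma mxtrace_outer A u v : \tr (A *m (u *m v^T)) = dot v (A *m u).
Proof. by rewrite mulmxA mxtrace_mulC /dot /mxtrace big_ord1. Qed.

(** Two forms of the same determinant, which differ by a transposition. *)
Lemma triple_swap e v u : dot v (crossmx e *m u) = - dot e (crossmx v *m u).
Proof. by rewrite !dotE !(mxE, big_ord3) /=; ring. Qed.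

Lemma triple0 u v : dot u (crossmx v *m u) = 0.
Proof. by rewrite !dotE !(mxE, big_ord3) /=; ring. Qed.

Lemma tr_quatmx_cross2 h e v u : h ^+ 2 + dot e e = 1 ->
  \tr (quatmx h e *m (crossmx v *m crossmx u)) =
  - (2 * h ^+ 2) * dot u v + 2 * dot e u * dot e v + 2 * h * dot v (crossmx e *m u).
Proof.
move=> he; rewrite crossmx_mul mulmxBr linearB /= mxtrace_outer mul_mx_scalar.
by rewrite linearZ /= tr_quatmx // dot_quatmx //; ring.
Qed.

(** For unit u, [u]^2 = u u^T - 1, which reduces the trace to the rotated vector
    X (v x u) and to [tr_quatmx_cross]. *)
Lemma tr_quatmx_cross3 h e v u : h ^+ 2 + dot e e = 1 -> dot u u = 1 ->
  \tr (quatmx h e *m crossmx v *m (crossmx u *m crossmx u)) =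
  2 * dot e u * dot e (crossmx v *m u) + 2 * h * (dot u v * dot e u + dot e v).
Proof.
move=> he hu; rewrite crossmx_mul mulmxBr linearB /= mxtrace_outer hu mulmx1.
rewrite tr_quatmx_cross -mulmxA dot_quatmx // [dot (_ *m _) u]dotC triple0.
have -> : dot u (crossmx e *m (crossmx v *m u)) =
    dot u v * dot e u - dot e v * dot u u.
  by rewrite !dotE !(mxE, big_ord3) /=; ring.
by rewrite hu; ring.
Qed.

Lemma dot_crossmx e u :
  dot (crossmx u *m e) (crossmx u *m e) = dot e e * dot u u - dot e u ^+ 2.
Proof. by rewrite !dotE !(mxE, big_ord3) /=; ring. Qed.

Lemma dot_sqr_le e u : dot u u = 1 -> dot e u ^+ 2 <= dot e e.
Proof.
move=> hu; rewrite -subr_ge0 -[X in X - _]mulr1 -[X in _ * X]hu.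
by rewrite -dot_crossmx dot_ge0.
Qed.

(** * The margin given by the bound on k *)

Lemma warp_cosP (k s : R) (c := Num.sqrt (1 - (k * s) ^+ 2)) :
  k ^+ 2 < 1 / 2 -> 0 <= s <= 1 ->
  [/\ 0 < c, c <= 1, c ^+ 2 = 1 - (k * s) ^+ 2 & 1 - k ^+ 2 <= c ^+ 2].
Proof.
move=> k2 /andP[s0 s1].
have kss : (k * s) ^+ 2 <= k ^+ 2.
  by rewrite exprMn ler_piMr ?sqr_ge0 // expr_le1.
have c2 : c ^+ 2 = 1 - (k * s) ^+ 2 by rewrite sqr_sqrtr; lra.
have c0 : 0 < c by rewrite sqrtr_gt0; lra.
split=> //; last by lra.
rewrite -(@expr_le1 _ 2) ?(ltW c0) // c2.
by move: (sqr_ge0 (k * s)); lra.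
Qed.

(** The number z is only known through z^2 <= k^2 h^2 s, so what is needed is
    c^2 - 4 k^2 h^2 s = 1 - k^2 (4 s - 3 s^2) > 0.  As 4 s - 3 s^2 is at most 4/3,
    k^2 < 1/2 leaves at least 1/3, and dividing by c - 2 z <= 2 leaves 1/6. *)
Lemma warp_margin (k s h p : R) (c := Num.sqrt (1 - (k * s) ^+ 2)) (z := k * h * p) :
  k ^+ 2 < 1 / 2 -> 0 <= s -> h ^+ 2 + s = 1 -> p ^+ 2 <= s ->
  [/\ 1 / 6 <= c + z, 1 / 6 <= c + 2 * z & z ^+ 2 <= (k * h) ^+ 2 * s].
Proof.
move=> k2 s0 hs ps.
have s1 : s <= 1 by move: (sqr_ge0 h); lra.
have [|c0 c1 c2 _] := warp_cosP k s k2; first by rewrite s0.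
have z2 : z ^+ 2 <= (k * h) ^+ 2 * s by rewrite exprMn ler_wpM2l ?sqr_ge0.
have key : 1 / 3 <= c ^+ 2 - 4 * z ^+ 2.
  have h2 : h ^+ 2 = 1 - s by lra.
  (* The maximum 4/3 of 4 s - 3 s^2 is attained at s = 2/3. *)
  have : k ^+ 2 * (4 * s - 3 * s ^+ 2) <= 1 / 2 * (4 / 3).
    have := sqr_ge0 (3 * s - 2); have := sqr_ge0 k.
    move: (k ^+ 2) k2 => K K2 K0 Q0.
    have Q1 : 0 <= 4 * s - 3 * s ^+ 2 by rewrite expr2; nra.
    apply: ler_pM => //; lra.
  by move: z2; rewrite c2 [(k * h) ^+ 2]exprMn [(k * s) ^+ 2]exprMn h2; lra.
have cz : 1 / 6 <= c + 2 * z.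
  move: key c0 c1; rewrite -/c; move: (c) (z) => c' z' key c0 c1.
  have [z0|z0] := leP 0 z'; first by nra.
  have d0 : 0 < c' - 2 * z' by lra.
  have m3 : 1 / 3 <= (c' + 2 * z') * (c' - 2 * z') by lra.
  have w0 : 0 < c' + 2 * z' by rewrite -(pmulr_lgt0 _ d0); lra.
  have : (c' + 2 * z') * (c' - 2 * z') <= (c' + 2 * z') * 2.
    by rewrite ler_pM2l //; lra.
  lra.
have cc : c ^+ 2 <= c by rewrite expr2 ler_piMr // ltW.
by split=> //; move: (sqr_ge0 z); lra.
Qed.

(** * Gradients on SO(3) *)

Lemma is_diff_mxtrace_mul A X :
  is_diff X (fun Y => \tr (Y *m A)) (fun Y => \tr (Y *m A)).
Proof.
pose f Y : R := \tr (Y *m A).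
have flin : linear f by move=> a Y Z; rewrite /f mulmxDl -scalemxAl linearP.
pose fM := GRing.isLinear.Build _ _ _ _ _ flin.
pose fL : {linear 'M[R]_3 -> R} := HB.pack f fM.
have fc : continuous fL.
  have -> : (fL : _ -> _) = (fun Y => \sum_i \sum_j Y i j * A j i).
    by apply/funext => Y; apply: eq_bigr => i _; rewrite mxE.
  apply: continuous_big => [|i _]; first exact: add_continuous.
  apply: continuous_big => [|j _ Y]; first exact: add_continuous.
  by apply: continuousM; [exact: coord_continuous | exact: cst_continuous].
apply: DiffDef; first exact: (linear_differentiable X fc).
exact: (diff_lin X fc).
Qed.

Lemma is_diff_sqrt (U : normedModType R) (f df : U -> R) (X : U) : 0 < f X ->
  is_diff X f df ->
  is_diff X (fun Y => Num.sqrt (f Y)) ((2 * Num.sqrt (f X))^-1 *: df).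
Proof.
move=> f0 dff.
have ds := is_derive1_sqrt f0.
have dfs : differentiable Num.sqrt (f X).
  by apply/derivable1_diffP; exact: ex_derive.
have : is_diff (f X) Num.sqrt ('d Num.sqrt (f X)) by exact: DiffDef.
move/(is_diff_comp dff) => dsf; apply: (is_diff_eq dsf).
apply/funext => H /=.
rewrite -[df H]mulr1 -[df H * 1]/(df H *: 1) linearZ /= -deriveE // derive_val.
exact: mulrC.
Qed.

Lemma so3_crossmx A : so3 A -> exists v, A = crossmx v.
Proof.
move=> skA; exists (col3 (A 2%:R 1) (A 0 2%:R) (A 1 0)).
have sk i j : A j i = - A i j by have /matrixP/(_ i j) := skA; rewrite !mxE.
have d i : A i i = 0 by have := sk i i; lra.
by apply/matrixP => i j; elim/ord3P: i; elim/ord3P: j; rewrite !mxE /=.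
Qed.

Lemma crossmxZ (a : R) v : crossmx (a *: v) = a *: crossmx v.
Proof.
by apply/matrixP => i j; elim/ord3P: i; elim/ord3P: j; rewrite !mxE /=; ring.
Qed.

Lemma crossmx0 : crossmx (0 : 'cV[R]_3) = 0.
Proof. by rewrite -[0](scale0r 0) crossmxZ !scale0r. Qed.

Lemma trmx_crossmx v : (crossmx v)^T = - crossmx v.
Proof.
by apply/matrixP => i j; elim/ord3P: i; elim/ord3P: j; rewrite !mxE /=; ring.
Qed.

Lemma SO3_mulKmx X A : SO3 X -> X^T *m (X *m A) = A.
Proof. by move=> [_ oX]; rewrite mulmxA (mulmx1C oX) mul1mx. Qed.

Lemma metricSO3_crossmx X v w : SO3 X ->
  metricSO3 X (X *m crossmx v) (X *m crossmx w) = 2 * dot v w.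
Proof.
move=> SX; rewrite /metricSO3 !SO3_mulKmx // trmx_crossmx mulNmx crossmx_mul.
by rewrite mxtrace3 !dotE !mxE !big_ord1 !mxE /=; ring.
Qed.

Lemma dot_eq u w : (forall v, dot u v = dot w v) -> u = w.
Proof.
move=> H; apply/matrixP => i j; rewrite ord1.
have := H (delta_mx i 0); rewrite !dotE !mxE.
by elim/ord3P: i => /=; lra.
Qed.

Lemma is_derive_scale (f : R -> R) (t df : R) A :
  is_derive t 1 f df -> is_derive t 1 (fun s => f s *: A) (df *: A).
Proof.
move=> fd; have dif : differentiable f t by apply/derivable1_diffP; exact: ex_derive.
apply: DeriveDef; first by apply/derivable1_diffP; exact: differentiableZl.
rewrite deriveE; last exact: differentiableZl.
by rewrite diffZl // -deriveE // derive_val.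
Qed.

(** These curves stay on SO(3) and have velocity X [v] at time 0; they reduce
    statements on the differential along the tangent space to the values on
    SO(3). *)
Lemma is_derive_curve X v :
  is_derive (0 : R) 1 (fun t => X *m rodrigues t v) (X *m crossmx v).
Proof.
pose K := X *m crossmx v; pose L := X *m (crossmx v *m crossmx v).
have -> : (fun t => X *m rodrigues t v) =
    (cst X + (fun t => sin t *: K)) + (cst L - (fun t => cos t *: L)).
  apply/funext => t; rewrite /rodrigues !mulmxDr mulmx1 -!scalemxAr scalerBl scale1r.
  by rewrite /K /L.
have dS := is_derive_scale sin 0 (cos 0) K (is_derive_sin _).
have dC := is_derive_scale cos 0 (- sin 0) L (is_derive_cos _).
have dX := is_deriveD (is_derive_cst X (0 : R) 1) dS.
have dL := is_deriveB (is_derive_cst L (0 : R) 1) dC.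
apply: (is_derive_eq (is_deriveD dX dL)).
by rewrite cos0 sin0 oppr0 scale0r scale1r subr0 addr0 add0r.
Qed.

(** The gradient does not depend on the extension chosen to compute it: along a
    curve on SO(3) through X both extensions agree with f, so they have the same
    derivative. *)
Lemma C1_extension_diff_unique (f : 'M[R]_3 -> R) X F1 F2 v : SO3 X ->
  C1_extension_at f X F1 -> C1_extension_at f X F2 ->
  'd F1 X (X *m crossmx v) = 'd F2 X (X *m crossmx v).
Proof.
move=> SX.
wlog uv : v / dot v v = 1 => [IH E1 E2|].
  have [v0|v0] := eqVneq (dot v v) 0.
    have -> : X *m crossmx v = 0 by rewrite (dot_eq0 _ v0) crossmx0 mulmx0.
    exact: (etrans (linear0 ('d F1 X)) (esym (linear0 ('d F2 X)))).
  have vp : 0 < dot v v by rewrite lt_def v0 dot_ge0.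
  have n0 : Num.sqrt (dot v v) != 0 by rewrite gt_eqF // sqrtr_gt0.
  have dZ (F : 'M[R]_3 -> R) a Y : 'd F X (a *: Y) = a *: 'd F X Y by exact: linearZ.
  have -> : X *m crossmx v =
      Num.sqrt (dot v v) *: (X *m crossmx ((Num.sqrt (dot v v))^-1 *: v)).
    by rewrite scalemxAr -crossmxZ scalerKV.
  set n := Num.sqrt _ in n0 *.
  have e := IH (n^-1 *: v); set Y := X *m _ in e *.
  refine (etrans (dZ F1 n Y) (etrans (congr1 _ (e _ E1 E2)) (esym (dZ F2 n Y)))).
  transitivity (n ^- 2 * dot v v); first by rewrite !dotE !mxE -exprVn; ring.
  by rewrite /n sqr_sqrtr ?ltW // mulVf.
move=> [W1 [oW1 W1X [dF1 _] E1]] [W2 [oW2 W2X [dF2 _] E2]].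
pose g t := X *m rodrigues t v.
have g0 : g 0 = X.
  by rewrite /g /rodrigues sin0 cos0 subrr !scale0r !addr0 mulmx1.
have dg := is_derive_curve X v; rewrite -/g in dg.
have gd : differentiable g (0 : R) by apply/derivable1_diffP; exact: ex_derive.
have gc : {for (0 : R), continuous g} by exact: differentiable_continuous.
have g1 : 'd g (0 : R) 1 = X *m crossmx v by rewrite -deriveE // derive_val.
have chain F : differentiable F X -> 'd F X (X *m crossmx v) = 'D_1 (F \o g) (0 : R).
  move=> dF; rewrite -g0 in dF.
  transitivity ('d F (g 0) ('d g (0 : R) 1)); first by rewrite g1 g0.
  rewrite deriveE; last exact: differentiable_comp.
  by have /(congr1 (fun h => h 1)) := diff_comp gd dF.
rewrite !chain; [|exact: dF2|exact: dF1].
apply: near_eq_derive.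
have Wg : nbhs (g 0) (W1 `&` W2).
  by apply: open_nbhs_nbhs; split; [exact: openI | rewrite g0].
near=> t.
have [W1t W2t] : (W1 `&` W2) (g t) by near: t; exact: gc.
have SOt : SO3 (g t).
  have [dr orr] := rodrigues_SO3 t uv; have [dX oX] := SX.
  split; first by rewrite det_mulmx dX dr mulr1.
  by rewrite trmx_mul mulmxA -[X *m _ *m _]mulmxA orr mulmx1.
by rewrite /= E1 ?E2 ?inE.
Unshelve. all: by end_near. Qed.

(** The metric between X [y] and X [v] is 2 (y . v), so the gradient is X [w / 2].
    It is unique because any gradient, through whatever extension, satisfies the
    same equations. *)
Lemma frobenius_gradSO3 (f : 'M[R]_3 -> R) X F w : SO3 X ->
  C1_extension_at f X F -> (forall v, 'd F X (X *m crossmx v) = dot w v) ->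
  frobenius (gradSO3 f X) ^+ 2 = dot w w / 2.
Proof.
move=> SX EF dF.
have [G0 [F' EF' dF']] : is_gradient f X (gradSO3 f X).
  apply: (@xgetI _ _ [set G | is_gradient f X G] (X *m crossmx (2^-1 *: w))).
  split; first by exists (crossmx (2^-1 *: w)) => //; exact: trmx_crossmx.
  exists F => // _ [A /so3_crossmx [v ->] <-]; rewrite dF metricSO3_crossmx //.
  by rewrite !dotE !mxE; lra.
have [A /so3_crossmx [y ->] Gy] := G0.
have yw : y = 2^-1 *: w.
  apply: dot_eq => v; have tv : tangentSO3 X (X *m crossmx v).
    by exists (crossmx v) => //; exact: trmx_crossmx.
  have := dF' _ tv.
  rewrite -(C1_extension_diff_unique f X F F' v SX EF EF') dF -Gy.
  rewrite metricSO3_crossmx // => e.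
  by move: e; rewrite !dotE !mxE; lra.
have trG : \tr ((gradSO3 f X)^T *m gradSO3 f X) = 2 * dot y y.
  by rewrite -Gy -(metricSO3_crossmx X) // /metricSO3 trmx_mul -mulmxA !SO3_mulKmx.
rewrite /frobenius sqr_sqrtr trG; first by rewrite yw !dotE !mxE; lra.
by rewrite mulr_ge0 // dot_ge0.
Qed.

Lemma is_diff_ext (U : normedModType R) (f g df dg : U -> R) (x : U) :
  is_diff x f df -> f =1 g -> df =1 dg -> is_diff x g dg.
Proof. by move=> fx /funext <- /funext <-. Qed.

(** * A C1 extension of the potential to the matrix space *)

(** On SO(3) this is k |X|_I^2, the sine of half the warping angle; unlike
    [normI], which is cut off at 0, it is affine in X on all matrices. *)
Definition warp_sin (k : R) X : R := k / 4 * (3 - \tr X).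

Definition warp_cos (k : R) X : R := Num.sqrt (1 - warp_sin k X ^+ 2).

(** (1 + tr (Gamma X)) / 4, the squared real part of the quaternion of the warped
    rotation, with the sine and cosine of the warping angle expanded by the
    double angle formulas. *)
Definition etasq (k : R) u X : R :=
  4^-1 * (1 + \tr X
    + 2 * (warp_sin k X * warp_cos k X * \tr (X *m crossmx u))
    + 2 * (warp_sin k X ^+ 2 * \tr (X *m (crossmx u *m crossmx u)))).

Definition Vext (k : R) u X : R := 1 - Num.sqrt (etasq k u X).

Definition warp_dom (k : R) u : set 'M[R]_3 :=
  [set X | warp_sin k X ^+ 2 < 1 /\ 0 < etasq k u X].

Lemma is_diff_mxtrace X : is_diff X (fun Y => \tr Y) (fun H => \tr H).
Proof.
by apply: (is_diff_ext _ _ _ _ _ _ (is_diff_mxtrace_mul 1%:M X)) => Y /=;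
  rewrite mulmx1.
Qed.

Lemma is_diff_warp_sin k X : is_diff X (warp_sin k) (fun H => - (k / 4) * \tr H).
Proof.
have d := is_diffB (is_diff_cst (3 : R) X) (is_diff_mxtrace X).
apply: (is_diff_ext _ _ _ _ _ _ (is_diffZ (k / 4) d)) => H //.
rewrite -[LHS]/(k / 4 * (0 - \tr H)); ring.
Qed.

Lemma is_diff_warp_cos k X : warp_sin k X ^+ 2 < 1 ->
  is_diff X (warp_cos k)
    (fun H => warp_sin k X * (k / 4) * \tr H / warp_cos k X).
Proof.
move=> x1; have ds := is_diff_warp_sin k X.
have dd := is_diffB (is_diff_cst (1 : R) X) (is_diffX 1 ds).
have pos : 0 < (cst 1 - warp_sin k ^+ 2 : 'M[R]_3 -> R) X.
  by rewrite -[X in _ < X]/(1 - warp_sin k X ^+ 2) subr_gt0.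
apply: (is_diff_ext _ _ _ _ _ _ (is_diff_sqrt _ _ _ _ pos dd)) => H //.
rewrite -[LHS]/((2 * warp_cos k X)^-1
  * (0 - (2 * warp_sin k X ^+ 1) * (- (k / 4) * \tr H))).
have r0 : warp_cos k X != 0 by rewrite gt_eqF // sqrtr_gt0 subr_gt0.
by field.
Qed.

Definition diff_etasq (k : R) u X H : R :=
  let x := warp_sin k X in let c := warp_cos k X in
  let dx := - (k / 4) * \tr H in
  4^-1 * (\tr H
    + 2 * (x * c * \tr (H *m crossmx u)
           + \tr (X *m crossmx u) * ((c - x ^+ 2 / c) * dx))
    + 2 * (x ^+ 2 * \tr (H *m (crossmx u *m crossmx u))
           + \tr (X *m (crossmx u *m crossmx u)) * (2 * x * dx))).

Lemma is_diff_etasq k u X : warp_sin k X ^+ 2 < 1 ->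
  is_diff X (etasq k u) (diff_etasq k u X).
Proof.
move=> x1; have ds := is_diff_warp_sin k X; have dc := is_diff_warp_cos k X x1.
have d1 := is_diffD (is_diff_cst (1 : R) X) (is_diff_mxtrace X).
have d2 := is_diffZ 2 (is_diffM (is_diffM ds dc) (is_diff_mxtrace_mul (crossmx u) X)).
have dK2 := is_diff_mxtrace_mul (crossmx u *m crossmx u) X.
have d3 := is_diffZ 2 (is_diffM (is_diffX 1 ds) dK2).
have d4 := is_diffZ 4^-1 (is_diffD (is_diffD d1 d2) d3).
apply: (is_diff_ext _ _ _ _ _ _ d4) => H //; rewrite /diff_etasq.
set x := warp_sin k X; set c := warp_cos k X.
set b := \tr (X *m crossmx u); set b2 := \tr (X *m (crossmx u *m crossmx u)).
rewrite -[LHS]/(4^-1 * (0 + \tr H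
  + 2 * (x * c * \tr (H *m crossmx u)
         + b * (x * (x * (k / 4) * \tr H / c) + c * (- (k / 4) * \tr H)))
  + 2 * (x ^+ 2 * \tr (H *m (crossmx u *m crossmx u))
         + b2 * (2 * x ^+ 1 * (- (k / 4) * \tr H))))).
ring.
Qed.

Lemma is_diff_Vext k u X : warp_dom k u X ->
  is_diff X (Vext k u)
    (fun H => - (2 * Num.sqrt (etasq k u X))^-1 * diff_etasq k u X H).
Proof.
move=> [x1 g0]; have dg := is_diff_sqrt _ _ _ _ g0 (is_diff_etasq k u X x1).
apply: (is_diff_ext _ _ _ _ _ _ (is_diffB (is_diff_cst (1 : R) X) dg)) => H //.
rewrite -[LHS]/(0 - (2 * Num.sqrt (etasq k u X))^-1 * diff_etasq k u X H); ring.
Qed.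

(* The pointwise forms of the continuity rules: the unifier recovers f and g from
   a sum or product of values, but not from a sum or product of functions. *)
Let cK (a : R) X : {for X, continuous (fun _ : 'M[R]_3 => a)}.
Proof. exact: cst_continuous. Qed.

Let cN (f : 'M[R]_3 -> R) X : {for X, continuous f} ->
  {for X, continuous (fun Y => - f Y)}.
Proof. exact: continuousN. Qed.

Let cD (f g : 'M[R]_3 -> R) X : {for X, continuous f} ->
  {for X, continuous g} -> {for X, continuous (fun Y => f Y + g Y)}.
Proof. exact: continuousD. Qed.

Let cB (f g : 'M[R]_3 -> R) X : {for X, continuous f} ->
  {for X, continuous g} -> {for X, continuous (fun Y => f Y - g Y)}.
Proof. exact: continuousB. Qed.

Let cM (f g : 'M[R]_3 -> R) X : {for X, continuous f} ->
  {for X, continuous g} -> {for X, continuous (fun Y => f Y * g Y)}.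
Proof. exact: continuousM. Qed.

Let cV (f : 'M[R]_3 -> R) X : f X != 0 -> {for X, continuous f} ->
  {for X, continuous (fun Y => (f Y)^-1)}.
Proof. exact: continuousV. Qed.

Lemma continuous_sqrt_for (f : 'M[R]_3 -> R) X : {for X, continuous f} ->
  {for X, continuous (fun Y => Num.sqrt (f Y))}.
Proof.
move=> cf; apply: (@continuous_comp _ _ _ f Num.sqrt) => //; exact: sqrt_continuous.
Qed.

Lemma continuous_sqr_for (f : 'M[R]_3 -> R) X : {for X, continuous f} ->
  {for X, continuous (fun Y => f Y ^+ 2)}.
Proof.
move=> cf; apply: (@continuous_comp _ _ _ f (fun r : R => r ^+ 2)) => //.
exact: exprn_continuous.
Qed.

Lemma continuous_mxtrace_mul A : continuous (fun X => \tr (X *m A)).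
Proof.
move=> X; apply: differentiable_continuous.
exact: (@ex_diff _ _ _ _ _ _ _ (is_diff_mxtrace_mul A X)).
Qed.

Lemma continuous_warp_sin k : continuous (warp_sin k).
Proof.
move=> X; apply: differentiable_continuous.
exact: (@ex_diff _ _ _ _ _ _ _ (is_diff_warp_sin k X)).
Qed.

Lemma continuous_warp_cos k : continuous (warp_cos k).
Proof.
move=> X; apply: continuous_sqrt_for; apply: cB; first exact: cK.
exact: continuous_sqr_for (@continuous_warp_sin k X).
Qed.

Lemma continuous_etasq k u : continuous (etasq k u).
Proof.
move=> X; have cs := @continuous_warp_sin k X; have cc := @continuous_warp_cos k X.
have ct : {for X, continuous (fun Y => \tr Y)}.
  apply: differentiable_continuous; exact: (@ex_diff _ _ _ _ _ _ _ (is_diff_mxtrace X)).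
apply: cM; first exact: cK.
apply: cD; first apply: cD; first apply: cD.
- exact: cK.
- exact: ct.
- apply: cM; first exact: cK.
  by apply: cM; [exact: cM | exact: continuous_mxtrace_mul].
- apply: cM; first exact: cK.
  apply: cM; last exact: continuous_mxtrace_mul.
  exact: continuous_sqr_for.
Qed.

Lemma continuous_Vext k u : continuous (Vext k u).
Proof.
move=> X; apply: cB; first exact: cK.
exact: continuous_sqrt_for (@continuous_etasq k u X).
Qed.

Lemma open_warp_dom k u : open (warp_dom k u).
Proof.
apply: openI.
  rewrite -[X in open X]/((fun X => warp_sin k X ^+ 2) @^-1` [set r | r < 1]).
  apply: open_comp; last exact: open_lt.
  move=> X _; exact: continuous_sqr_for (@continuous_warp_sin k X).
rewrite -[X in open X]/(etasq k u @^-1` [set r | 0 < r]).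
by apply: open_comp; [move=> X _; exact: continuous_etasq | exact: open_gt].
Qed.

Lemma continuous_diff_etasq k u H X : warp_sin k X ^+ 2 < 1 ->
  {for X, continuous (fun Y => diff_etasq k u Y H)}.
Proof.
move=> x1; have cs := @continuous_warp_sin k X; have cc := @continuous_warp_cos k X.
have c0 : warp_cos k X != 0 by rewrite gt_eqF // sqrtr_gt0 subr_gt0.
have cs2 : {for X, continuous (fun Y => warp_sin k Y ^+ 2)}.
  exact: continuous_sqr_for.
have kst (a : R) : {for X, continuous (fun=> a)} by exact: cK.
have tr A : {for X, continuous (fun Y : 'M[R]_3 => \tr (Y *m A))}.
  exact: continuous_mxtrace_mul.
apply: cM; first exact: kst.
apply: cD; first apply: cD.
- exact: kst.
- apply: cM; first exact: kst.
  apply: cD; first by apply: cM; [exact: cM | exact: kst].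
  apply: cM; first exact: tr.
  apply: cM; last exact: kst.
  apply: cB; first exact: cc.
  by apply: cM; [exact: cs2 | exact: cV].
- apply: cM; first exact: kst.
  apply: cD; first by apply: cM; [exact: cs2 | exact: kst].
  apply: cM; first exact: tr.
  apply: cM; last exact: kst.
  by apply: cM; [exact: kst | exact: cs].
Qed.

Lemma continuous_near_eq (f g : 'M[R]_3 -> R) X : {near X, f =1 g} ->
  {for X, continuous f} -> {for X, continuous g}.
Proof.
move=> fg cf; have e : f X = g X := nbhs_singleton fg.
rewrite /prop_for /continuous_at -e.
exact: cvg_trans (near_eq_cvg fg) cf.
Qed.

(** The differential has the explicit form given by [is_diff_Vext] on an open
    set, and that form is continuous in the base point. *)
Lemma C1_on_Vext k u : C1_on (warp_dom k u) (Vext k u).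
Proof.
split=> [X WX|H X /[!inE] WX].
  exact: (@ex_diff _ _ _ _ _ _ _ (is_diff_Vext k u X WX)).
pose dV Y := - (2 * Num.sqrt (etasq k u Y))^-1 * diff_etasq k u Y H.
have dVE : {in warp_dom k u, forall Y, 'd (Vext k u) Y H = dV Y}.
  by move=> Y /[!inE] WY; have -> := @diff_val _ _ _ _ _ _ _ (is_diff_Vext k u Y WY).
have [x1 g0] := WX.
have cdV : {for X, continuous dV}.
  apply: cM; last exact: continuous_diff_etasq.
  apply: cN; apply: cV.
    by rewrite mulf_neq0 // gt_eqF // sqrtr_gt0.
  apply: cM; first exact: cK.
  exact: continuous_sqrt_for (@continuous_etasq k u X).
apply: (continuous_near_eq dV _ X _ cdV).
have : nbhs X (warp_dom k u) by apply: open_nbhs_nbhs; split; first exact: open_warp_dom.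
by apply: filterS => Y /mem_set WY; exact: esym (dVE Y WY).
Qed.

(** * The warped potential in quaternion coordinates *)

(** The real part of the product of the quaternion (h, e) with (c, k s u). *)
Definition warped_real (k h : R) e u : R :=
  h * Num.sqrt (1 - (k * dot e e) ^+ 2) - k * dot e e * dot e u.

Lemma normI_quat h e : h ^+ 2 + dot e e = 1 ->
  normI (quatmx h e) ^+ 2 = dot e e.
Proof.
move=> he; have trE : \tr (1%:M - quatmx h e) / 4 = dot e e.
  by rewrite linearB /= mxtrace1 tr_quatmx //; lra.
by rewrite /normI trE sqr_sqrtr // dot_ge0.
Qed.

Lemma warp_sin_quat k h e : h ^+ 2 + dot e e = 1 ->
  warp_sin k (quatmx h e) = k * dot e e.
Proof.
move=> he; rewrite /warp_sin tr_quatmx //.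
have -> : dot e e = 1 - h ^+ 2 by lra.
by field.
Qed.

Lemma unit_quat_le1 (h : R) e : h ^+ 2 + dot e e = 1 -> 0 <= dot e e <= 1.
Proof. by move=> he; rewrite dot_ge0 /=; move: (sqr_ge0 h); lra. Qed.

Lemma tr_Gamma (Q : Type) k (u : Q -> 'cV[R]_3) h e q :
  k ^+ 2 < 1 / 2 -> h ^+ 2 + dot e e = 1 ->
  \tr (Gamma k u (quatmx h e) q) = 4 * etasq k (u q) (quatmx h e) - 1.
Proof.
move=> k2 he; have s01 := unit_quat_le1 _ _ he; have [s0 s1] := andP s01.
have [c0 c1 c2 _] := warp_cosP k (dot e e) k2 s01.
have x1 : -1 <= k * dot e e <= 1.
  rewrite -ler_norml -(@expr_le1 _ 2) // real_normK ?num_real //.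
  by move: (sqr_ge0 (Num.sqrt (1 - (k * dot e e) ^+ 2))); lra.
rewrite /Gamma normI_quat // /etasq /warp_cos warp_sin_quat //.
set a := asin _; have sa : sin a = k * dot e e by rewrite asinK // in_itv.
have ca : cos a = Num.sqrt (1 - (k * dot e e) ^+ 2) by rewrite cos_asin.
have -> : 2 * a = a + a by ring.
rewrite /rodrigues sinD cosD sa ca.
rewrite !mulmxDr mulmx1 -!scalemxAr !mxtraceD !mxtraceZ.
move: c2; set c := Num.sqrt _ => c2; rewrite -[c * c]expr2 c2.
by field.
Qed.

Lemma etasq_quat k h e u : k ^+ 2 < 1 / 2 -> h ^+ 2 + dot e e = 1 ->
  dot u u = 1 -> etasq k u (quatmx h e) = warped_real k h e u ^+ 2.
Proof.
move=> k2 he hu; have [c0 c1 c2 _] := warp_cosP k (dot e e) k2 (unit_quat_le1 _ _ he).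
rewrite /etasq /warp_cos /warped_real warp_sin_quat // tr_quatmx //.
rewrite tr_quatmx_cross tr_quatmx_cross2 // triple0 hu.
move: c2; set c := Num.sqrt _; move: (dot e e) (dot e u) => s p c2.
have e1 : h ^+ 2 * c ^+ 2 = h ^+ 2 * (1 - (k * s) ^+ 2) by rewrite c2.
lra.
Qed.

(** This is the squared length of the vector part c e + k s h u + k s (e x u) of
    the product.  Split along e and orthogonally to it: h u and e x u contribute
    orthogonal vectors of squared lengths h^2 (s - p^2) / s and s - p^2, whose
    weights add up since h^2 + s = 1. *)
Lemma warped_real_sq k h e u (c := Num.sqrt (1 - (k * dot e e) ^+ 2)) :
  k ^+ 2 < 1 / 2 -> h ^+ 2 + dot e e = 1 ->
  1 - warped_real k h e u ^+ 2 =
  dot e e * ((c + k * h * dot e u) ^+ 2 + k ^+ 2 * (dot e e - dot e u ^+ 2)).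
Proof.
move=> k2 he; have [_ _ c2 _] := warp_cosP k (dot e e) k2 (unit_quat_le1 _ _ he).
rewrite /warped_real -/c in c2 *.
move: he c2; move: (dot e e) (dot e u) => s p he c2.
have e1 : h ^+ 2 * c ^+ 2 = (1 - s) * (1 - (k * s) ^+ 2) by rewrite c2 -he; ring.
have e2 : s * c ^+ 2 = s * (1 - (k * s) ^+ 2) by rewrite c2.
have e3 : s * (k ^+ 2 * p ^+ 2 * h ^+ 2) = s * (k ^+ 2 * p ^+ 2 * (1 - s)).
  by rewrite -he; ring.
lra.
Qed.

Lemma V_Gamma (Q : Type) k (u : Q -> 'cV[R]_3) h e q
    (n := warped_real k h e (u q)) :
  k ^+ 2 < 1 / 2 -> h ^+ 2 + dot e e = 1 -> dot (u q) (u q) = 1 ->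
  [/\ n ^+ 2 <= 1, normI (Gamma k u (quatmx h e) q) ^+ 2 = 1 - n ^+ 2 &
      V (Gamma k u (quatmx h e) q) = 1 - `|n| ].
Proof.
move=> k2 he hu; have n1 : n ^+ 2 <= 1.
  rewrite -subr_ge0 /n warped_real_sq // mulr_ge0 ?dot_ge0 //.
  by rewrite addr_ge0 ?sqr_ge0 // mulr_ge0 ?sqr_ge0 // subr_ge0 dot_sqr_le.
have nI : normI (Gamma k u (quatmx h e) q) ^+ 2 = 1 - n ^+ 2.
  have trE : \tr (1%:M - Gamma k u (quatmx h e) q) / 4 = 1 - n ^+ 2.
    by rewrite linearB /= mxtrace1 tr_Gamma // etasq_quat // -/n; lra.
  by rewrite /normI trE sqr_sqrtr // subr_ge0.
split=> //; rewrite /V nI; have -> : 1 - (1 - n ^+ 2) = n ^+ 2 by ring.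
by rewrite sqrtr_sqr.
Qed.

Lemma Vext_quat k h e u : k ^+ 2 < 1 / 2 -> h ^+ 2 + dot e e = 1 ->
  dot u u = 1 -> Vext k u (quatmx h e) = 1 - `|warped_real k h e u|.
Proof. by move=> k2 he hu; rewrite /Vext etasq_quat // sqrtr_sqr. Qed.

(** The component of [gradvec] along e: besides c it collects the variation of
    s = |e|^2 inside the warping angle. *)
Definition gradcoef k h e u : R :=
  let c := Num.sqrt (1 - (k * dot e e) ^+ 2) in
  c + 2 * h ^+ 2 * k ^+ 2 * dot e e / c + 2 * k * h * dot e u.

(** Moving X with velocity X [v] changes h by - (e . v) / 2 and e by
    (h v + e x v) / 2; [warped_real] then changes by - (gradvec . v) / 2. *)
Definition gradvec k h e u : 'cV[R]_3 :=
  gradcoef k h e u *: e + (k * dot e e * h) *: u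
  + (k * dot e e) *: (crossmx u *m e).

(** The squared real part n^2 has derivative 2 n n', where n' is
    - (gradvec . v) / 2. *)
Lemma diff_etasq_quat k h e u v : k ^+ 2 < 1 / 2 -> h ^+ 2 + dot e e = 1 ->
  dot u u = 1 ->
  diff_etasq k u (quatmx h e) (quatmx h e *m crossmx v) =
  - warped_real k h e u * dot (gradvec k h e u) v.
Proof.
move=> k2 he hu; have [c0 c1 c2 _] := warp_cosP k (dot e e) k2 (unit_quat_le1 _ _ he).
rewrite /diff_etasq /warp_cos /gradvec /gradcoef /warped_real.
rewrite !dotDl !dotZl warp_sin_quat // [dot (_ *m _) v]dotC.
rewrite tr_quatmx_cross3 // -mulmxA (tr_quatmx_cross2 h e v u) //.
rewrite (tr_quatmx_cross2 h e u u) //.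
rewrite !tr_quatmx_cross triple0 hu (triple_swap e v u).
have -> : dot v (crossmx u *m e) = dot e (crossmx v *m u).
  by rewrite !dotE !(mxE, big_ord3) /=; ring.
move: c2 c0; set c := Num.sqrt _ => c2 c0.
move: (dot e e) (dot e u) (dot e v) (dot u v) (dot e (crossmx v *m u)) c2.
move=> s p q r m c2.
(* The identity holds modulo these multiples of c^2 = 1 - k^2 s^2 and
   c c^-1 = 1. *)
have e1 : h * q * c ^+ 2 = h * q * (1 - (k * s) ^+ 2) by rewrite c2.
have e2 : h ^+ 3 * k ^+ 2 * s * q * (c * c^-1) = h ^+ 3 * k ^+ 2 * s * q.
  by rewrite mulfV ?mulr1 ?gt_eqF.
move: (c^-1) e1 e2 => i e1 e2.
lra.
Qed.

Lemma diff_Vext_quat k h e u v : k ^+ 2 < 1 / 2 -> h ^+ 2 + dot e e = 1 ->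
  dot u u = 1 -> warp_dom k u (quatmx h e) ->
  'd (Vext k u) (quatmx h e) (quatmx h e *m crossmx v) =
  dot ((warped_real k h e u / (2 * `|warped_real k h e u|)) *: gradvec k h e u) v.
Proof.
move=> k2 he hu W.
have /(congr1 (fun f => f (quatmx h e *m crossmx v))) :=
  @diff_val _ _ _ _ _ _ _ (is_diff_Vext k u _ W).
move=> dE; apply: (etrans dE).
by rewrite diff_etasq_quat // etasq_quat // sqrtr_sqr dotZl; ring.
Qed.

(** Same orthogonal splitting as in [warped_real_sq], with c replaced by the
    coefficient of e. *)
Lemma dot_gradvec k h e u :
  h ^+ 2 + dot e e = 1 -> dot u u = 1 ->
  dot (gradvec k h e u) (gradvec k h e u) =
  dot e e * ((gradcoef k h e u + k * h * dot e u) ^+ 2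
             + k ^+ 2 * (dot e e - dot e u ^+ 2)).
Proof.
move=> he hu; rewrite /gradvec; move: (gradcoef _ _ _ _) => A.
rewrite !(dotDl, dotZl, dotDr, dotZr) dot_crossmx hu [dot u e]dotC.
rewrite ![dot _ (crossmx u *m e)]dotC.
have -> : dot (crossmx u *m e) e = 0 by rewrite !dotE !(mxE, big_ord3) /=; ring.
have -> : dot (crossmx u *m e) u = 0 by rewrite !dotE !(mxE, big_ord3) /=; ring.
rewrite ?dot_crossmx; move: (dot e e) (dot e u) he => s p he.
have e1 : s * k ^+ 2 * (h ^+ 2 * p ^+ 2) = s * k ^+ 2 * ((1 - s) * p ^+ 2).
  by rewrite -he; ring.
have e2 : s ^+ 2 * k ^+ 2 * h ^+ 2 = s ^+ 2 * k ^+ 2 * (1 - s) by rewrite -he; ring.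
lra.
Qed.

(** Both brackets are squares plus a nonnegative term, so the lower bounds only
    need c + z >= 1/6 and A + z >= 1/36; the second follows from the product
    (c + z) (c + 2 z), each factor of which is at least 1/6. *)
Lemma warp_factor_bounds k h e u (s := dot e e) (p := dot e u)
    (c := Num.sqrt (1 - (k * s) ^+ 2)) (z := k * h * p) :
  k ^+ 2 < 1 / 2 -> h ^+ 2 + s = 1 -> dot u u = 1 ->
  s / 36 <= s * ((c + z) ^+ 2 + k ^+ 2 * (s - p ^+ 2)) <= s * 4 /\
  s / 36 ^+ 2 <= s * ((gradcoef k h e u + z) ^+ 2 + k ^+ 2 * (s - p ^+ 2)) <= s * 37.
Proof.
move=> k2 hs hu; have s01 := unit_quat_le1 _ _ hs; rewrite -/s in s01.
have [s0 s1] := andP s01.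
have [c0 c1 c2 ck] := warp_cosP k s k2 s01.
have ps : p ^+ 2 <= s by exact: dot_sqr_le.
have [cz c2z z2] := warp_margin k s h p k2 s0 hs ps.
rewrite -/c -/z in c0 c1 c2 ck cz c2z z2.
have z2' : z ^+ 2 <= k ^+ 2.
  apply: le_trans z2 _; rewrite exprMn -mulrA ler_piMr ?sqr_ge0 //.
  by rewrite mulr_ile1 ?sqr_ge0 //; lra.
have d0 : 0 <= k ^+ 2 * (s - p ^+ 2) by rewrite mulr_ge0 ?sqr_ge0 ?subr_ge0.
have d1 : k ^+ 2 * (s - p ^+ 2) <= 1.
  by rewrite mulr_ile1 ?sqr_ge0 //; move: (sqr_ge0 p); lra.
have cc : c ^+ 2 <= c by rewrite expr2 ler_piMr // ltW.
have ch : 1 / 2 <= c by lra.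
split.
  have : (1 / 6) ^+ 2 <= (c + z) ^+ 2 by apply: lerXn2r; rewrite ?nnegrE; lra.
  have : (c + z) ^+ 2 <= 3 by move: (sqr_ge0 (c - z)); lra.
  by move=> ? ?; apply/andP; split; rewrite ler_wpM2l //; lra.
set A := gradcoef k h e u.
have cA : c * (A + z) = c ^+ 2 + 3 * (c * z) + 2 * ((k * h) ^+ 2 * s).
  by rewrite /A /gradcoef -/s -/c -/p /z; field; rewrite gt_eqF.
have Alo : 1 / 36 <= A + z.
  have : 1 / 6 * (1 / 6) <= (c + z) * (c + 2 * z) by apply: ler_pM; lra.
  have : 1 / 36 <= c * (A + z) -> 1 / 36 <= A + z.
    move=> h1; have A0 : 0 < A + z by rewrite -(pmulr_rgt0 _ c0); lra.
    by apply: le_trans h1 _; rewrite ler_piMl // ltW.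
  by move=> h1 h2; apply: h1; rewrite cA; lra.
have Ahi : A + z <= 6.
  have kh : (k * h) ^+ 2 * s <= 1 / 2.
    apply: le_trans (ltW k2); rewrite exprMn -mulrA ler_piMr ?sqr_ge0 //.
    by rewrite mulr_ile1 ?sqr_ge0 //; move: (sqr_ge0 h); lra.
  have z1 : z <= 1 by move: (sqr_ge0 (z - 1)); lra.
  have : c * (A + z) <= c * 6.
    rewrite cA; have : c * z <= c * 1 by rewrite ler_pM2l.
    lra.
  by rewrite ler_pM2l.
have : (1 / 36) ^+ 2 <= (A + z) ^+ 2 by apply: lerXn2r; rewrite ?nnegrE; lra.
have : (A + z) ^+ 2 <= 6 ^+ 2 by apply: lerXn2r; rewrite ?nnegrE; lra.
by move=> ? ?; apply/andP; split; rewrite ler_wpM2l //; lra.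
Qed.

(** * The synergy gap *)

Lemma parseval (u : 'I_3 -> 'cV[R]_3) e :
  (forall i j, dot (u i) (u j) = (i == j)%:R) ->
  \sum_i dot e (u i) ^+ 2 = dot e e.
Proof.
move=> hu; pose U : 'M[R]_3 := \matrix_(i, j) u i j 0.
have UU : U *m U^T = 1%:M.
  by apply/matrixP => i j; rewrite mulmx3E !mxE -hu dotE.
have Ue i : (U *m e) i 0 = dot e (u i).
  by rewrite mxE big_ord3 !mxE dotC dotE.
transitivity (dot (U *m e) (U *m e)).
  by rewrite (dotE (U *m e)) !Ue big_ord3 !expr2.
by rewrite /dot trmx_mul -mulmxA [U^T *m _]mulmxA (mulmx1C UU) mul1mx.
Qed.

(** The positive root r of k^2 r^2 = 1 - r: the least value of |X|_I^2 among the
    rotations that a warping along some unit vector sends to a half-turn. *)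
Definition singular_radius (k : R) := (-1 + Num.sqrt (1 + 4 * k ^+ 2)) / (2 * k ^+ 2).

Lemma singular_radiusP k (r := singular_radius k) : 0 < k ->
  [/\ 0 < r, r < 1 & k ^+ 2 * r ^+ 2 = 1 - r].
Proof.
move=> k0; have K0 : 0 < k ^+ 2 by rewrite exprn_gt0.
set w := Num.sqrt (1 + 4 * k ^+ 2).
have w2 : w ^+ 2 = 1 + 4 * k ^+ 2 by rewrite sqr_sqrtr; lra.
have w0 : 0 <= w by exact: sqrtr_ge0.
have w1 : 1 < w.
  by rewrite -(@ltr_pXn2r _ 2) ?nnegrE // w2 expr1n; lra.
have rE : 2 * k ^+ 2 * r = w - 1.
  by rewrite /r /singular_radius -/w; field; rewrite gt_eqF.
have rq : k ^+ 2 * r ^+ 2 = 1 - r.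
  have k40 : 4 * k ^+ 2 != 0 by rewrite mulf_neq0 // gt_eqF.
  apply: (mulfI k40).
  have -> : 4 * k ^+ 2 * (k ^+ 2 * r ^+ 2) = (2 * k ^+ 2 * r) ^+ 2 by ring.
  have -> : 4 * k ^+ 2 * (1 - r) = 4 * k ^+ 2 - 2 * (2 * k ^+ 2 * r) by ring.
  by rewrite rE; lra.
have r0 : 0 < r by rewrite -(@pmulr_rgt0 _ (2 * k ^+ 2)) ?rE; lra.
split=> //; have : 0 < k ^+ 2 * r ^+ 2 by rewrite mulr_gt0 // exprn_gt0.
lra.
Qed.

Lemma delta_barE k : 0 < k ->
  (-1 + Num.sqrt (1 + 4 * k ^+ 2)) `^ (3 / 2) / (2 * Num.sqrt 6 * k ^+ 2) =
  k * singular_radius k * Num.sqrt (singular_radius k / 3).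
Proof.
move=> k0; have [r0 r1 _] := singular_radiusP k k0.
have K0 : 0 < k ^+ 2 by rewrite exprn_gt0.
have yE : -1 + Num.sqrt (1 + 4 * k ^+ 2) = 6 * (k ^+ 2 * (singular_radius k / 3)).
  by rewrite /singular_radius; field; rewrite gt_eqF.
rewrite yE; move: (singular_radius k) r0 r1 {yE} => r r0 r1.
have r30 : 0 <= r / 3 by lra.
have y0 : 0 < 6 * (k ^+ 2 * (r / 3)) by rewrite !mulr_gt0 //; lra.
have -> : 3 / 2 = 1 + 2^-1 :> R by field.
rewrite powRD ?(gt_eqF y0) ?implybT // powRr1 ?ltW // powR12_sqrt ?ltW //.
rewrite sqrtrM // sqrtrM ?sqr_ge0 // sqrtr_sqr gtr0_norm //.
field; rewrite (gt_eqF k0) gt_eqF // sqrtr_gt0; lra.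
Qed.

Lemma singular_radius_le k h e u : 0 < k -> k ^+ 2 < 1 / 2 -> h ^+ 2 + dot e e = 1 ->
  dot u u = 1 -> warped_real k h e u = 0 -> singular_radius k <= dot e e.
Proof.
move=> k0 k2 he hu; have [r0 r1 rE] := singular_radiusP k k0.
have [_ _ c2 _] := warp_cosP k (dot e e) k2 (unit_quat_le1 _ _ he).
have ps := dot_sqr_le e u hu; have s0 := dot_ge0 e.
rewrite /warped_real; move: (Num.sqrt _) c2 => c c2 /eqP.
rewrite subr_eq0 => /eqP /(congr1 (fun t : R => t ^+ 2)); rewrite !exprMn c2.
move: (dot e e) (dot e u) ps s0 he {c2} => s p ps s0 he e1.
have K0 : 0 <= k ^+ 2 by rewrite sqr_ge0.
have : k ^+ 2 * s ^+ 2 * p ^+ 2 <= k ^+ 2 * s ^+ 2 * s.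
  by rewrite ler_wpM2l // mulr_ge0 ?sqr_ge0.
have h2 : h ^+ 2 = 1 - s by lra.
rewrite -e1 h2 exprMn => ineq.
rewrite leNgt; apply/negP => sr.
have : k ^+ 2 * s ^+ 2 <= k ^+ 2 * singular_radius k ^+ 2.
  by rewrite ler_wpM2l // lerXn2r ?nnegrE // ltW.
lra.
Qed.

(** The midpoint of r and 1 separates two regimes.  Beyond it the growth of
    k s sqrt (s / 3) alone beats the threshold k r sqrt (r / 3); before it the
    cosine term |h| c stays bounded away from 0. *)
Definition gap_bound (k : R) : R :=
  let r := singular_radius k in let s := (1 + r) / 2 in
  Num.min (k * s * Num.sqrt (s / 3))
    (Num.sqrt ((1 - s) * (1 - k ^+ 2)) + k * r * Num.sqrt (r / 3)).

Lemma gap_bound_gt k : 0 < k -> k ^+ 2 < 1 / 2 ->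
  k * singular_radius k * Num.sqrt (singular_radius k / 3) < gap_bound k.
Proof.
move=> k0 k2; have [r0 r1 _] := singular_radiusP k k0.
rewrite /gap_bound; move: (singular_radius k) r0 r1 => r r0 r1.
rewrite lt_min ltrDr sqrtr_gt0 mulr_gt0 ?andbT; [|lra..].
have lt_sqrt : Num.sqrt (r / 3) < Num.sqrt ((1 + r) / 2 / 3) by rewrite ltr_sqrt; lra.
rewrite -[k * r * _]mulrA -[k * ((1 + r) / 2) * _]mulrA ltr_pM2l //.
by apply: ltr_pM => //; lra.
Qed.

Lemma gap_bound_le k h s (c := Num.sqrt (1 - (k * s) ^+ 2)) :
  0 < k -> k ^+ 2 < 1 / 2 -> h ^+ 2 + s = 1 -> singular_radius k <= s -> s <= 1 ->
  gap_bound k <= `|h| * c + k * s * Num.sqrt (s / 3).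
Proof.
move=> k0 k2 hs rs s1; have [r0 r1 _] := singular_radiusP k k0.
have [|c0 _ _ ck] := warp_cosP k s k2; first by rewrite s1; lra.
rewrite -/c in c0 ck.
have mono a b : 0 < a -> a <= b ->
    k * a * Num.sqrt (a / 3) <= k * b * Num.sqrt (b / 3).
  move=> a0 ab; rewrite -!mulrA ler_pM2l //; apply: ler_pM => //.
  - exact: ltW.
  - by rewrite ler_wsqrtr //; lra.
rewrite /gap_bound ge_min; apply/orP.
have [ss|ss] := leP ((1 + singular_radius k) / 2) s; [left|right].
  apply: le_trans (mono _ _ _ ss) _; first lra.
  by rewrite lerDr mulr_ge0 // ltW.
apply: lerD; last exact: mono.
have -> : `|h| * c = Num.sqrt (h ^+ 2 * c ^+ 2).
  by rewrite -exprMn sqrtr_sqr normrM (gtr0_norm c0).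
by rewrite ler_wsqrtr //; apply: ler_pM; lra.
Qed.

Definition signed_frame (u : 'I_(3 + 3) -> 'cV[R]_3) : Prop :=
  (forall i j, dot (u (lshift 3 i)) (u (lshift 3 j)) = (i == j)%:R) /\
  (forall m, u (rshift 3 m) = - u (lshift 3 m)).

Lemma frame_unit (u : 'I_(3 + 3) -> 'cV[R]_3) q :
  signed_frame u -> dot (u q) (u q) = 1.
Proof.
move=> [hu huN]; case: (split_ordP q) => i ->; first by rewrite hu eqxx.
by rewrite huN -scaleN1r dotZl dotZr !mulN1r opprK hu eqxx.
Qed.

(** The three squared coordinates of e add up to |e|^2. *)
Lemma large_coordinate (u : 'I_(3 + 3) -> 'cV[R]_3) e : signed_frame u ->
  exists i, dot e e / 3 <= dot e (u (lshift 3 i)) ^+ 2.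
Proof.
move=> [hu _]; have := parseval _ e hu; rewrite big_ord3 => sumE.
apply: contrapT => /forallNP H.
have lt3 i : dot e (u (lshift 3 i)) ^+ 2 < dot e e / 3.
  by rewrite ltNge; apply/negP.
by move: (lt3 0) (lt3 1) (lt3 2%:R); lra.
Qed.

(** The sign of u_m is chosen so that the two terms of [warped_real] reinforce
    each other; this is the role of the three opposite vectors. *)
Lemma large_warped_real k (u : 'I_(3 + 3) -> 'cV[R]_3) h e :
  0 < k -> k ^+ 2 < 1 / 2 ->
  h ^+ 2 + dot e e = 1 -> signed_frame u ->
  exists m, `|h| * Num.sqrt (1 - (k * dot e e) ^+ 2)
            + k * dot e e * Num.sqrt (dot e e / 3) <= `|warped_real k h e (u m)|.
Proof.
move=> k0 k2 he uf; have [i ei] := large_coordinate u e uf.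
have [c0 _ _ _] := warp_cosP k (dot e e) k2 (unit_quat_le1 _ _ he).
set a := dot e (u (lshift 3 i)) in ei.
have aN : dot e (u (rshift 3 i)) = - a.
  by case: uf => _ ->; rewrite -scaleN1r dotZr mulN1r.
have ks : 0 <= k * dot e e by rewrite mulr_ge0 ?dot_ge0 // ltW.
have ra : k * dot e e * Num.sqrt (dot e e / 3) <= k * dot e e * `|a|.
  by rewrite ler_wpM2l // -sqrtr_sqr ler_wsqrtr.
have [mp mpE] : exists m, dot e (u m) = `|a|.
  have [a0|a0] := leP 0 a; [exists (lshift 3 i) | exists (rshift 3 i)].
    by rewrite ger0_norm.
  by rewrite aN ltr0_norm.
have [mn mnE] : exists m, dot e (u m) = - `|a|.
  have [a0|a0] := leP 0 a; [exists (rshift 3 i) | exists (lshift 3 i)].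
    by rewrite aN ger0_norm.
  by rewrite ltr0_norm // opprK.
move: c0; rewrite /warped_real; set c := Num.sqrt (1 - _) => c0.
have [h0|h0] := leP 0 h; [exists mn | exists mp].
  rewrite mnE (ger0_norm h0); apply: le_trans (ler_norm _); move: ra; lra.
rewrite mpE -[leRHS]normrN; apply: le_trans (ler_norm _).
rewrite (ltr0_norm h0); move: ra; lra.
Qed.

Lemma SO3_Vext (Q : Type) k (u : Q -> 'cV[R]_3) q X : k ^+ 2 < 1 / 2 ->
  dot (u q) (u q) = 1 -> SO3 X -> Vext k (u q) X = V (Gamma k u X q).
Proof.
move=> k2 hu /SO3_quat [h [e [he ->]]].
by have [_ _ ->] := V_Gamma Q k u h e q k2 he hu; rewrite Vext_quat.
Qed.

Lemma quat_warp_dom k h e u : k ^+ 2 < 1 / 2 -> h ^+ 2 + dot e e = 1 ->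
  dot u u = 1 -> warped_real k h e u != 0 -> warp_dom k u (quatmx h e).
Proof.
move=> k2 he hu n0; split.
  rewrite warp_sin_quat //.
  have [c0 _ c2 _] := warp_cosP k (dot e e) k2 (unit_quat_le1 _ _ he).
  have : 0 < Num.sqrt (1 - (k * dot e e) ^+ 2) ^+ 2 by rewrite exprn_gt0.
  lra.
by rewrite etasq_quat // exprn_even_gt0.
Qed.

Lemma Vext_extension (Q : Type) k (u : Q -> 'cV[R]_3) q X : k ^+ 2 < 1 / 2 ->
  dot (u q) (u q) = 1 -> warp_dom k (u q) X ->
  C1_extension_at (fun Y => V (Gamma k u Y q)) X (Vext k (u q)).
Proof.
move=> k2 hu WX; exists (warp_dom k (u q)); split => //.
- exact: open_warp_dom.
- exact: C1_on_Vext.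
- by move=> Y; rewrite inE => -[_ SY]; exact: SO3_Vext.
Qed.

(** * Exponential synergism *)

(** For 0 <= a <= 1, (1 - a^2) / 2 <= 1 - a <= 1 - a^2; apply this to the absolute
    value of the warped real part and use [warped_real_sq]. *)
Lemma V_Gamma_bounds (Q : Type) k (u : Q -> 'cV[R]_3) q X : k ^+ 2 < 1 / 2 ->
  dot (u q) (u q) = 1 -> SO3 X ->
  1 / 72 * normI X ^+ 2 <= V (Gamma k u X q) <= 4 * normI X ^+ 2.
Proof.
move=> k2 hu /SO3_quat [h [e [he ->]]]; rewrite normI_quat //.
have [n1 _ ->] := V_Gamma Q k u h e q k2 he hu.
have := warp_factor_bounds k h e (u q) k2 he hu; rewrite -warped_real_sq //.
move=> [/andP[lo hi] _].
have a0 := normr_ge0 (warped_real k h e (u q)).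
move: lo hi n1; rewrite -[_ ^+ 2]real_normK ?num_real //.
move: (`|_|) a0 => a a0 lo hi a21.
have a1 : a <= 1 by rewrite -(@expr_le1 _ 2).
have aa : a ^+ 2 <= a by rewrite expr2 ler_piMr.
by move: (sqr_ge0 (1 - a)) => a2; apply/andP; split; lra.
Qed.

Lemma normI_Gamma_eq1 (Q : Type) k (u : Q -> 'cV[R]_3) q h e : k ^+ 2 < 1 / 2 ->
  h ^+ 2 + dot e e = 1 -> dot (u q) (u q) = 1 ->
  normI (Gamma k u (quatmx h e) q) = 1 <-> warped_real k h e (u q) = 0.
Proof.
move=> k2 he hu; have [n1 nI _] := V_Gamma Q k u h e q k2 he hu.
split=> [N1|n0].
  by apply/eqP; rewrite -sqrf_eq0; apply/eqP; move: nI; rewrite N1 expr1n; lra.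
have : normI (Gamma k u (quatmx h e) q) ^+ 2 = 1 by rewrite nI n0; ring.
move/eqP; rewrite sqrp_eq1 ?sqrtr_ge0 //; exact: eqP.
Qed.

Lemma SO3_1 : SO3 (1%:M : 'M[R]_3).
Proof. by split; rewrite ?det1 // trmx1 mulmx1. Qed.

Lemma quatmx_eq1 h e : dot e e = 0 -> quatmx h e = 1%:M.
Proof.
move/dot_eq0 ->; rewrite /quatmx crossmx0.
by rewrite mul0mx !scaler0 !addr0.
Qed.

Lemma V_Gamma_potential (Q : finType) k (u : Q -> 'cV[R]_3) : k ^+ 2 < 1 / 2 ->
  (forall q, dot (u q) (u q) = 1) ->
  potential [set p | SO3 p.1 /\ normI (Gamma k u p.1 p.2) <> 1]
            (fun X q => V (Gamma k u X q)).
Proof.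
move=> k2 hu.
have bounds X q SX := V_Gamma_bounds Q k u q X k2 (hu q) SX.
split.
- move=> X q SX; have /andP[lo _] := bounds X q SX.
  by apply: le_trans lo; rewrite mulr_ge0 ?sqr_ge0.
- move=> q; apply: (@subspace_eq_continuous _ _ _ (Vext k (u q))).
    by move=> X /[!inE] SX; exact: SO3_Vext.
  exact/continuous_subspaceT/continuous_Vext.
- move=> X q SX X1; have /andP[lo _] := bounds X q SX.
  apply: lt_le_trans lo; have [h [e [he XE]]] := SO3_quat X SX.
  rewrite XE normI_quat // mulr_gt0 // lt_def dot_ge0 andbT.
  by apply: contra X1 => /eqP e0; rewrite XE quatmx_eq1.
- move=> q; have := bounds 1%:M q SO3_1.
  have -> : normI (1%:M : 'M[R]_3) = 0 by rewrite /normI subrr mxtrace0 mul0r sqrtr0.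
  by rewrite expr0n /= !mulr0 => /le_anti.
- move=> q X [/= SX N1]; exists (Vext k (u q)); apply: Vext_extension => //.
  have [h [e [he XE]]] := SO3_quat X SX; rewrite XE in N1 *.
  apply: quat_warp_dom => //; apply/eqP => n0; apply: N1.
  exact/normI_Gamma_eq1.
Qed.

(** On the whole domain of differentiability the squared gradient norm is
    |gradvec|^2 / 8, since d(1 - |n|) = (n / (2 |n|)) (gradvec . v). *)
Lemma gradient_bounds (Q : Type) k (u : Q -> 'cV[R]_3) q X : k ^+ 2 < 1 / 2 ->
  dot (u q) (u q) = 1 -> SO3 X -> normI (Gamma k u X q) <> 1 ->
  1 / (8 * 36 ^+ 2) * normI X ^+ 2
    <= frobenius (gradSO3 (fun Y => V (Gamma k u Y q)) X) ^+ 2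
    <= 37 / 8 * normI X ^+ 2.
Proof.
move=> k2 hu SX N1; have [h [e [he XE]]] := SO3_quat X SX.
rewrite XE in SX N1 *.
have n0 : warped_real k h e (u q) != 0.
  by apply/eqP => n0; apply: N1; exact/normI_Gamma_eq1.
have W := quat_warp_dom k h e (u q) k2 he hu n0.
have ext := Vext_extension Q k u q _ k2 hu W.
have dE v := diff_Vext_quat k h e (u q) v k2 he hu W.
rewrite (frobenius_gradSO3 _ _ _ _ SX ext dE) normI_quat // dotZl dotZr.
rewrite dot_gradvec //.
have [_ /andP[lo hi]] := warp_factor_bounds k h e (u q) k2 he hu.
move: lo hi; set w := dot e e * (_ + _) => lo hi.
have -> : (warped_real k h e (u q) / (2 * `|warped_real k h e (u q)|)
   * (warped_real k h e (u q) / (2 * `|warped_real k h e (u q)|) * w)) = w / 4.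
  rewrite mulrA -expr2 expr_div_n exprMn real_normK ?num_real //.
  by field; rewrite n0.
by apply/andP; split; lra.
Qed.

(** At a point where the warped rotation is a half-turn the potential is 1, while
    [large_warped_real] bounds its minimum over the indices by 1 - gap_bound. *)
Lemma flow_set_regular k (u : 'I_(3 + 3) -> 'cV[R]_3) delta :
  0 < k -> k ^+ 2 < 1 / 2 ->
  signed_frame u -> delta < gap_bound k ->
  flow_set delta (fun X q => V (Gamma k u X q)) `<=`
  [set p | SO3 p.1 /\ normI (Gamma k u p.1 p.2) <> 1].
Proof.
move=> k0 k2 uf dlt [X q] [/= SX Uq]; split=> //= N1.
have hu m := frame_unit u m uf.
have [h [e [he XE]]] := SO3_quat X SX; rewrite XE in Uq N1.
have n0 : warped_real k h e (u q) = 0 by apply/normI_Gamma_eq1.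
have [m mge] := large_warped_real k u h e k0 k2 he uf.
have VE j : V (Gamma k u (quatmx h e) j) = 1 - `|warped_real k h e (u j)|.
  by have [_ _ ->] := V_Gamma _ k u h e j k2 he (hu j).
have minle := bigmin_le (V (Gamma k u (quatmx h e) q)) m
  (fun j => V (Gamma k u (quatmx h e) j)).
have gap := gap_bound_le k h (dot e e) k0 k2 he
  (singular_radius_le k h e (u q) k0 k2 he (hu q) n0)
  (proj2 (andP (unit_quat_le1 _ _ he))).
rewrite /= (VE m) in minle; rewrite [X in X - _]VE n0 normr0 in Uq.
move: Uq minle mge gap dlt; set b := \big[_/_]_j _; lra.
Qed.

End ExpSynergism.

Theorem proposition1 (R : realType) (k : R) (u : 'I_(3 + 3) -> 'cV[R]_3)
  (hk0 : 0 < k) (hk : k < 1 / Num.sqrt 2)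
  (hu : forall i j : 'I_3,
     ((u (lshift 3 i))^T *m u (lshift 3 j)) 0 0 = (i == j)%:R)
  (huN : forall m : 'I_3, u (rshift 3 m) = - u (lshift 3 m)) :
  let VGamma := fun (X : 'M[R]_3) (q : 'I_(3 + 3)) => V (Gamma k u X q) in
  let D := [set p : 'M[R]_3 * 'I_(3 + 3) |
              SO3 p.1 /\ normI (Gamma k u p.1 p.2) <> 1] in
  let delta_bar :=
    (-1 + Num.sqrt (1 + 4 * k ^+ 2)) `^ (3 / 2) / (2 * Num.sqrt 6 * k ^+ 2) in
  potential D VGamma /\
  exists delta : R, delta_bar < delta /\ exp_synergistic D delta VGamma.
Proof.
move=> VGamma D delta_bar.
have k2 : k ^+ 2 < 1 / 2.
  have s20 : 0 < Num.sqrt 2 :> R by rewrite sqrtr_gt0.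
  have -> : 1 / 2 = (1 / Num.sqrt 2) ^+ 2 :> R.
    by rewrite expr_div_n expr1n sqr_sqrtr.
  by rewrite ltr_pXn2r ?nnegrE ?divr_ge0 // ltW.
have uf : signed_frame u by split.
have unit q := frame_unit u q uf.
have pot : potential D VGamma by exact: V_Gamma_potential.
have gap := gap_bound_gt k hk0 k2.
have dbE : delta_bar = k * singular_radius k * Num.sqrt (singular_radius k / 3).
  exact: delta_barE.
have db0 : 0 < delta_bar.
  have [r0 _ _] := singular_radiusP k hk0.
  rewrite dbE; apply: mulr_gt0; first exact: mulr_gt0.
  by rewrite sqrtr_gt0 divr_gt0.
rewrite -dbE in gap; split=> //; exists ((delta_bar + gap_bound k) / 2).
have sub : flow_set ((delta_bar + gap_bound k) / 2) VGamma `<=` D.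
  by apply: flow_set_regular => //; lra.
split; first by lra.
split=> //; first by lra.
exists (1 / 72), 4, (1 / (8 * 36 ^+ 2)), (37 / 8).
refine (And4 _ (fun X q SX => V_Gamma_bounds _ k u q X k2 (unit q) SX) _ sub).
  by split; lra.
intros X q f; have [/= SX N1] := sub _ f.
exact (gradient_bounds _ k u q X k2 (unit q) SX N1).
Qed.
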